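(* Let $p\in(0,1)$ and $\beta>-1$, and let $\Xi_n$ be the position at time $n$ of the laziest elephant random walk with power law memory with parameters $(p,\beta)$. Then for every $n\in\mathbb{N}=\{1,2,\dots\}$, $$E[\Xi_n]=\begin{cases}\dfrac{p(\beta+1)}{p(\beta+1)-\beta}\cdot\dfrac{c_n(p(\beta+1))}{c_n(\beta)}+\dfrac{\beta}{\beta-p(\beta+1)} & \text{if } \beta\neq\dfrac{p}{1-p},\\[2mm] \displaystyle\sum_{k=0}^{n-1}\dfrac{\beta}{k+\beta} & \text{if } \beta=\dfrac{p}{1-p}.\end{cases}$$
   Context: For $\xi>-1$ and $n\in\mathbb{N}$ put $c_n(\xi):=\dfrac{\Gamma(n+\xi)}{\Gamma(n)\Gamma(\xi+1)}$, and $\mu_n:=c_n(\beta)$. Laziest elephant random walk with power law memory, with parameters $p\in(0,1)$, $\beta>-1$: let $\{\beta_{n+1}:n\in\mathbb{N}\}$ be independent random variables with $$P(\beta_{n+1}=k)=\frac{\beta+1}{n}\cdot\frac{\mu_k}{\mu_{n+1}}\quad (1\le k\le n),$$ and $P(\beta_{n+1}=k)=0$ otherwise (this is a probability mass function). Set $X_1\equiv 1$ and, for $n\ge 1$, $X_{n+1}=X_{\beta_{n+1}}$ with probability $p$ and $X_{n+1}=0$ with probability $1-p$; that is, $X_{n+1}=\alpha_{n+1}X_{\beta_{n+1}}$, where the $\alpha_{n+1}$ are i.i.d. Bernoulli($p$) random variables independent of $\{\beta_{n+1}\}$. The walk is $\Xi_0=0$, $\Xi_n=\sum_{k=1}^n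 X_k$. *)

(* Defs.v *)
From HB Require Import structures.
From mathcomp Require Import all_boot all_order all_algebra finmap.
From mathcomp Require Import all_classical all_reals all_analysis.

Set Implicit Arguments.
Unset Strict Implicit.
Unset Printing Implicit Defensive.

Import Order.TTheory GRing.Theory Num.Theory.
Import numFieldNormedType.Exports.

Local Open Scope classical_set_scope.
Local Open Scope ring_scope.

(* Euler's integral; it is the Gamma function only for [0 < x]. *)
Definition Gamma (R : realType) (x : R) : R :=
  \int[lebesgue_measure]_(t in `]0, +oo[) (t `^ (x - 1) * expR (- t)).

(* Meaningful for [0 < n] and [-1 < xi], where all three arguments of [Gamma]
   are positive. *)
Definition c (R : realType) (n : nat) (xi : R) : R :=
  Gamma (n%:R + xi) / (Gamma n%:R * Gamma (xi + 1)).

Section independence.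
Context (d : measure_display) (T : measurableType d) (R : realType).
Variable P : probability T R.

Definition mutually_independent (I : choiceType) (D : set I)
    (d' : measure_display) (T' : measurableType d')
    (X : I -> {RV P >-> T'}) : Prop :=
  forall (J : {fset I}) (A : I -> set T'),
    [set` J] `<=` D -> (forall i, i \in J -> measurable (A i)) ->
    P (\bigcap_(i in [set` J]) (X i @^-1` A i)) =
    (\prod_(i <- J) P (X i @^-1` A i))%E.

Definition sigma_family (I : Type) (D : set I)
    (d' : measure_display) (T' : measurableType d')
    (X : I -> {RV P >-> T'}) : set (set T) :=
  <<s \bigcup_(i in D) preimage_set_system setT (X i) measurable >>.

Definition independent_families (I : Type) (D : set I)
    (d1 : measure_display) (T1 : measurableType d1) (X : I -> {RV P >-> T1})
    (d2 : measure_display) (T2 : measurableType d2) (Y : I -> {RV P >-> T2})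
    : Prop :=
  forall A B : set T, sigma_family D X A -> sigma_family D Y B ->
    P (A `&` B) = (P A * P B)%E.

End independence.

(* [beta] is the memory exponent and [b n] the remembered time at step [n].
   [alpha n] and [b n] are only constrained for [2 <= n], and [X n] only for
   [1 <= n].  The recursion is required almost surely, since [b n.+1] lies in
   {1, ..., n} only almost surely. *)
Record laziest_elephant (d : measure_display) (T : measurableType d)
    (R : realType) (P : probability T R) (p beta : R)
    (alpha : nat -> {RV P >-> bool}) (b : nat -> {RV P >-> nat})
    (X : nat -> {RV P >-> R}) : Prop := LaziestElephant {
  memory_law : forall n k : nat, (1 <= n)%N ->
    P (b n.+1 @^-1` [set k]) =
    (if (1 <= k <= n)%N
     then (beta + 1) / n%:R * (c k beta / c n.+1 beta) else 0)%:E ;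
  memory_indep : mutually_independent [set n | (2 <= n)%N] b ;
  coin_law : forall n : nat, (1 <= n)%N ->
    distribution P (alpha n.+1) = bernoulli_prob p :> (set bool -> \bar R) ;
  coin_indep : mutually_independent [set n | (2 <= n)%N] alpha ;
  coin_memory_indep : independent_families [set n | (2 <= n)%N] alpha b ;
  first_step : forall t : T, X 1%N t = 1 ;
  next_step : forall n : nat, (1 <= n)%N ->
    {ae P, forall t, X n.+1 t = (alpha n.+1 t)%:R * X (b n.+1 t) t} }.

Definition walk (T : Type) (R : realType) (X : nat -> T -> R) (n : nat)
  : T -> R := fun t => \sum_(1 <= k < n.+1) X k t.

(* Main.v *)
Require Import Defs.
From HB Require Import structures.
From mathcomp Require Import all_boot all_order all_algebra finmap.
From mathcomp Require Import ring lra.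
From mathcomp Require Import all_classical all_reals all_analysis.
From mathcomp Require Import measurable_realfun.

Import Order.TTheory GRing.Theory Num.Theory.
Import numFieldNormedType.Exports.

Local Open Scope classical_set_scope.
Local Open Scope ring_scope.

Set Implicit Arguments.
Unset Strict Implicit.

(** Why the formula holds.  Read the recursion for the steps backwards: the step
at time [n] is a copy of the step at the remembered time, which is in turn a copy,
and so on along a line of descent that ends at time [1].  So [X n] is almost surely
the indicator of the event [alive n] that every coin met on the way down shows
heads, and the mean position is the sum of the [P (alive k)], [1 <= k <= n]
([expectation_walk]).

Descent from time [k] only looks at coins and memories of times at most [k].
Hence [alive k] is independent of whatever happens at later times
([alive_indep]), and splitting [alive n.+1] according to the remembered time gives
[prob_aliveS]: with [a n = P (alive n)] and [g = p * (beta + 1)],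
  [a n.+1 = g / (n * c n.+1 beta) * \sum_(1 <= k <= n) c k beta * a k].
The weighted sum on the right obeys a first order recursion, the one that
[c n g] satisfies because [c n.+1 g = (n + g) / n * c n g]; they agree at [n = 1],
so the sum is [c n g] ([weighted_sum_mean]).  The means are then explicit, and
their sum telescopes since
  [c n.+1 g / c n.+1 beta - c n g / c n beta
     = (g - beta) / (n + beta) * (c n g / c n beta)],
unless [g = beta], that is [beta = p / (1 - p)]: then [a n.+1 = beta / (n + beta)]
and the sum is the one of the second case ([sum_mean]).

Three properties of the Gamma function enter: it is finite and positive on the
positive reals, [Gamma 1 = 1], and [Gamma (x + 1) = x * Gamma x].  The functional
equation is proved first for the integral with values in the extended reals, by
parts on [1/(n+2), n+2] and passage to the limit, so it presupposes no convergence;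
finiteness and positivity then follow from it by comparison. *)

(** * The Gamma function *)

Definition euler_integrand (R : realType) (x : R) (t : R) : R :=
  t `^ (x - 1) * expR (- t).

Lemma is_derive_expRN (R : realType) (t : R) :
  is_derive t 1 (fun t : R => expR (- t)) (- expR (- t)).
Proof.
have D := is_derive1_comp (is_derive_expR (- t)) (is_deriveN (is_derive_id t 1)).
by apply: (is_derive_eq D); rewrite mulrN1.
Qed.

Lemma continuous_expRN (R : realType) : continuous (fun t : R => expR (- t)).
Proof.
move=> t; have [+ _] := is_derive_expRN t.
by move=> /derivable1_diffP/differentiable_continuous.
Qed.

Lemma is_derive_euler (R : realType) (x t : R) : 0 < t ->
  is_derive t 1 (fun t : R => t `^ x * expR (- t))
    (x * euler_integrand x t - euler_integrand (x + 1) t).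
Proof.
move=> t0; rewrite /euler_integrand addrK.
apply: (is_derive_eq (is_deriveM (is_derive1_powR x t0) (is_derive_expRN t))).
by rewrite /GRing.scale/= mulrN addrC mulrA (mulrC (expR _)).
Qed.

Lemma continuous_euler (R : realType) (x a b : R) : 0 < a ->
  {within `[a, b], continuous (euler_integrand x)}.
Proof.
move=> a0; apply: derivable_within_continuous => t.
rewrite in_itv/= => /andP[/(lt_le_trans a0) t0 _].
have := is_derive_euler (x - 1) t0.
by case.
Qed.

Lemma integrable_euler (R : realType) (x a b : R) : 0 < a ->
  lebesgue_measure.-integrable `[a, b] (EFin \o euler_integrand x).
Proof.
move=> a0; apply: continuous_compact_integrable; first exact: segment_compact.
exact: continuous_euler.
Qed.

Lemma euler_by_parts (R : realType) (x a b : R) : 0 < a -> a < b ->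
  (x%:E * \int[lebesgue_measure]_(t in `[a, b]) (euler_integrand x t)%:E =
   \int[lebesgue_measure]_(t in `[a, b]) (euler_integrand (x + 1) t)%:E +
   (b `^ x * expR (- b) - a `^ x * expR (- a))%:E)%E.
Proof.
move=> a0 ab.
pose F (t : R) : R := t `^ x * expR (- t).
have dF t : a <= t -> is_derive t (1 : R) F
    (x * euler_integrand x t - euler_integrand (x + 1) t).
  by move=> /(lt_le_trans a0) t0; exact: is_derive_euler.
have Ix := integrable_euler x b a0; have Ix1 := integrable_euler (x + 1) b a0.
have cF t : a <= t -> {for t, continuous F}.
  by move=> /dF[+ _] => /derivable1_diffP/differentiable_continuous.
have := @continuous_FTC2 R
  (fun t => x * euler_integrand x t - euler_integrand (x + 1) t) F a b ab.
rewrite EFinB => <-; last 3 first.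
- move=> t; apply: cvgB; last exact: continuous_euler.
  by apply: cvgM; [exact: cvg_cst|exact: continuous_euler].
- split.
  + by move=> t; rewrite in_itv/= => /andP[/ltW/dF[]].
  + by apply: cvg_at_right_filter; exact: cF.
  + by apply: cvg_at_left_filter; apply: cF; exact: ltW.
- by move=> t; rewrite in_itv/= => /andP[/ltW/dF[_ +]] _; rewrite derive1E.
rewrite -integralZl//.
have -> : (\int[lebesgue_measure]_(t in `[a, b])
      (x * euler_integrand x t - euler_integrand (x + 1) t)%:E =
    \int[lebesgue_measure]_(t in `[a, b])
      ((x * euler_integrand x t)%:E - (euler_integrand (x + 1) t)%:E))%E by [].
rewrite integralB_EFin//; last first.
  exact: (eq_integrable _ _ _ _ (integrableZl _ x Ix)).
by rewrite addeC subeK// integrable_fin_num.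
Qed.

(** The boundary terms of the integration by parts on [1/(n+2), n+2]; the shift by
[2] keeps the two endpoints apart. *)
Lemma cvg_euler_boundary (R : realType) (x : R) : 0 < x ->
  n.+2%:R `^ x * expR (- n.+2%:R) -
  (n.+2%:R^-1) `^ x * expR (- (n.+2%:R^-1)) @[n --> \oo] --> (0 : R).
Proof.
move=> x0.
have invn0 : (n.+2%:R^-1 : R) @[n --> \oo] --> (0 : R).
  by have := @cvg_harmonic R; rewrite -[X in X -> _]cvg_shiftS.
rewrite -[X in _ --> X](subr0 0); apply: cvgB.
(* for an integer [m >= x]: [t^x <= t^m] on [1, +oo[ and [e^t >= t^(m+1) / (m+1)!],
   so the upper boundary term is at most [(m+1)! / (n+2)] *)
- pose m := (Num.truncn x).+1.
  have xm : x <= m%:R by rewrite ltW// truncnS_gt.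
  apply: (@squeeze_cvgr _ _ _ _ (fun=> 0) (fun n => m.+1`!%:R * n.+2%:R^-1)).
  + near=> n; rewrite mulr_ge0 ?powR_ge0 ?expR_ge0//=.
    have n1 : (1 : R) <= n.+2%:R by rewrite ler1n.
    have n0 : (0 : R) < n.+2%:R by rewrite ltr0n.
    rewrite (@le_trans _ _ (n.+2%:R ^+ m * expR (- n.+2%:R)))//.
      rewrite ler_pM2r ?expR_gt0// -powR_mulrn ?(ltW n0)//.
      exact: ler_powR.
    rewrite expRN ler_pdivrMr ?expR_gt0// mulrAC ler_pdivlMr// -exprSr.
    rewrite -ler_pdivrMl ?ltr0n ?fact_gt0// mulrC.
    apply: le_trans (expR_ge1Dxn m (ltW n0)).
    by rewrite lerDr.
  + exact: cvg_cst.
  + by rewrite -[X in _ --> X](mulr0 m.+1`!%:R); apply: cvgMr.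
- apply: (@squeeze_cvgr _ _ _ _ (fun=> 0) (fun n => n.+2%:R^-1 `^ x)).
  + near=> n; rewrite mulr_ge0 ?powR_ge0 ?expR_ge0//=.
    by rewrite ler_piMr ?powR_ge0// -expR0 ler_expR oppr_le0 invr_ge0.
  + exact: cvg_cst.
  + have /cvg_at_rightP := powR_cvg0 x0; apply; split.
Unshelve. all: by end_near. Qed.

Lemma euler_ge0 (R : realType) (x t : R) : 0 <= euler_integrand x t.
Proof. by rewrite mulr_ge0 ?powR_ge0 ?expR_ge0. Qed.

Lemma measurable_euler (R : realType) (x : R) (D : set R) :
  measurable_fun D (EFin \o euler_integrand x).
Proof.
apply/measurable_EFinP; apply: measurable_funTS; apply: measurable_funM.
  exact: measurable_powR.
by apply: measurableT_comp.
Qed.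

Definition euler_integral (R : realType) (x : R) : \bar R :=
  (\int[lebesgue_measure]_(t in `]0%R, +oo[) (euler_integrand x t)%:E)%E.

Lemma euler_integral_ge0 (R : realType) (x : R) : (0 <= euler_integral x)%E.
Proof. by apply: integral_ge0 => t _; rewrite lee_fin euler_ge0. Qed.

Definition compact_exhaustion (R : realType) (n : nat) : set R :=
  `[n.+2%:R^-1, n.+2%:R]%classic.

Lemma cvg_euler_integral (R : realType) (x : R) :
  (\int[lebesgue_measure]_(t in @compact_exhaustion R n) (euler_integrand x t)%:E)%E
    @[n --> \oo] --> euler_integral x.
Proof.
have -> : euler_integral x = (\int[lebesgue_measure]_(t in
    \bigcup_n @compact_exhaustion R n) (euler_integrand x t)%:E)%E.
  congr (integral _ _ _); apply/seteqP; split => t /=.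
    rewrite in_itv/= andbT => t0.
    exists (Num.truncn (t + t^-1)) => //; rewrite /compact_exhaustion/= in_itv/=.
    have tS : t + t^-1 < (Num.truncn (t + t^-1)).+1%:R by exact: truncnS_gt.
    have lS : (Num.truncn (t + t^-1)).+1%:R <= (Num.truncn (t + t^-1)).+2%:R :> R.
      by rewrite ler_nat.
    have ti : 0 < t^-1 by rewrite invr_gt0.
    apply/andP; split; last lra.
    rewrite -[leRHS]invrK lef_pV2 ?posrE ?ltr0n//; lra.
  move=> [n _] /=; rewrite /compact_exhaustion/= !in_itv/= andbT => /andP[+ _].
  by apply: lt_le_trans; rewrite invr_gt0.
apply: ge0_nondecreasing_set_cvg_integral => //.
- move=> n m nm; rewrite subsetEset => t; rewrite /compact_exhaustion/= !in_itv/=.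
  move=> /andP[nt tn].
  apply/andP; split.
    by apply: le_trans nt; rewrite lef_pV2 ?posrE ?ltr0n// ler_nat !ltnS.
  by apply: (le_trans tn); rewrite ler_nat !ltnS.
- by move=> n; exact: measurable_itv.
- by move=> n; exact: measurable_euler.
- by move=> n t _; rewrite lee_fin euler_ge0.
Qed.

(** An identity between extended reals: both sides are limits of the integrals over
the compact exhaustion, finite or not. *)
Lemma euler_integralS (R : realType) (x : R) : 0 < x ->
  euler_integral (x + 1) = (x%:E * euler_integral x)%E.
Proof.
move=> x0; apply/esym.
have L := cvgeZl (y := x%:E) isT (@cvg_euler_integral R x).
have L1 := @cvg_euler_integral R (x + 1).
have B : ((n.+2%:R `^ x * expR (- n.+2%:R) -
    (n.+2%:R^-1) `^ x * expR (- (n.+2%:R^-1)))%:E : \bar R)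
    @[n --> \oo] --> (0%:E : \bar R).
  by apply: cvg_EFin; [exact: nearW|exact: cvg_euler_boundary].
have LR := cvgeD (fin_num_adde_defl _ (isT : 0%:E \is a fin_num)) L1 B.
rewrite adde0 in LR.
have parts n : (x%:E * \int[lebesgue_measure]_(t in @compact_exhaustion R n)
    (euler_integrand x t)%:E)%E =
    (\int[lebesgue_measure]_(t in @compact_exhaustion R n)
      (euler_integrand (x + 1) t)%:E +
    (n.+2%:R `^ x * expR (- n.+2%:R) -
     (n.+2%:R^-1) `^ x * expR (- (n.+2%:R^-1)))%:E)%E.
  apply: euler_by_parts; first by rewrite invr_gt0.
  by rewrite (@le_lt_trans _ _ 1)// ?invf_le1// ?ler1n ?ltr1n.
move: L; under eq_fun do rewrite parts.
by move=> L; apply: (cvg_unique (@ereal_hausdorff R) L (LR _)).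
Qed.

Lemma euler_integral1 (R : realType) : euler_integral 1 = 1%:E :> \bar R.
Proof.
rewrite /euler_integral integral_itv_obnd_cbnd//; last exact: measurable_euler.
have -> : euler_integrand 1 = (fun t => expR (- t)) :> (R -> R).
  by apply/funext => t; rewrite /euler_integrand subrr powRr0 mul1r.
have D (t : R) : is_derive t 1 (fun t : R => - expR (- t)) (expR (- t)).
  rewrite -[X in is_derive _ _ _ X]opprK.
  exact: is_deriveN (is_derive_expRN t).
rewrite (@ge0_continuous_FTC2y _ _ (fun t => - expR (- t)) _ 0).
- by rewrite oppr0 expR0 EFinN oppeK add0e.
- by move=> t _; exact: expR_ge0.
- exact/continuous_subspaceT/continuous_expRN.
- by rewrite -oppr0; apply: cvgN; exact: cvgr_expR.
- by move=> t _; case: (D t).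
- by apply: cvg_at_right_filter; apply: cvgN; exact: continuous_expRN.
- by move=> t _; rewrite derive1E; case: (D t).
Qed.

Lemma euler_integral_nat (R : realType) (m : nat) :
  (euler_integral (m.+1%:R : R) < +oo)%E.
Proof.
elim: m => [|m IH]; first by rewrite euler_integral1 ltry.
by rewrite -[m.+2]addn1 natrD euler_integralS// lte_mul_pinfty.
Qed.

(** Between the integer points, where the functional equation gives finiteness,
the bound is [t^(x - 1) <= 1 + t^(m - 1)] for an integer [m >= x]. *)
Lemma euler_integral_ge1_lty (R : realType) (x : R) : 1 <= x ->
  (euler_integral x < +oo)%E.
Proof.
move=> x1; pose m := (Num.truncn x).+1.
have xm : x <= m%:R by rewrite ltW// truncnS_gt.
apply: (@le_lt_trans _ _ (euler_integral 1 + euler_integral (m%:R : R))%E); last first.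
  by rewrite lte_add_pinfty// ?euler_integral1 ?ltry ?euler_integral_nat.
rewrite -ge0_integralD//; last 4 first.
- by move=> t _; rewrite lee_fin euler_ge0.
- exact: measurable_euler.
- by move=> t _; rewrite lee_fin euler_ge0.
- exact: measurable_euler.
apply: ge0_le_integral => //.
- by move=> t _; rewrite lee_fin euler_ge0.
- exact: measurable_euler.
- by apply: emeasurable_funD; exact: measurable_euler.
move=> t; rewrite /= in_itv/= andbT => t0.
rewrite -EFinD lee_fin -mulrDl ler_pM2r ?expR_gt0// subrr powRr0.
have [t1|t1] := leP t 1.
  rewrite ler_wpDr ?powR_ge0//.
  by rewrite -[leRHS](powRr0 t) ger_powR ?t0// subr_ge0.
by rewrite ler_wpDl// ler_powR ?(ltW t1)// lerB.
Qed.

(** On [1, 2] the integrand is at least [e^(-2)] as soon as [1 <= x]. *)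
Lemma euler_integral_ge1_gt0 (R : realType) (x : R) : 1 <= x ->
  (0 < euler_integral x)%E.
Proof.
move=> x1.
apply: (@lt_le_trans _ _
  (\int[lebesgue_measure]_(t in `[1%R, 2%R]) (expR (- 2))%:E)%E).
  rewrite integral_cst//=.
  have -> : lebesgue_measure `[1%R : R, 2%R : R]%classic = 1%:E.
    rewrite lebesgue_measure_itv/= lte_fin ifT; last lra.
    by rewrite -EFinB; congr EFin; lra.
  by rewrite mule1 lte_fin expR_gt0.
apply: (@le_trans _ _
  (\int[lebesgue_measure]_(t in `[1%R, 2%R]) (euler_integrand x t)%:E)%E).
  apply: ge0_le_integral => //.
  - exact: measurable_euler.
  move=> t; rewrite /= in_itv/= => /andP[t1 t2].
  rewrite lee_fin -[leLHS]mul1r ler_pM ?expR_ge0//; last by rewrite ler_expR lerN2.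
  by rewrite -[leLHS](powRr0 t) ler_powR// subr_ge0.
apply: ge0_subset_integral => //.
- exact: measurable_euler.
- by move=> t _; rewrite lee_fin euler_ge0.
- move=> t; rewrite /= !in_itv/= andbT => /andP[+ _]; exact: lt_le_trans.
Qed.

(** The case [x < 1], where the integrand is unbounded at [0], is reduced to
[1 <= x] by the functional equation. *)
Lemma euler_integral_fin_gt0 (R : realType) (x : R) : 0 < x ->
  (0 < euler_integral x < +oo)%E.
Proof.
move=> x0.
have x1 : 1 <= x + 1 by rewrite lerDr ltW.
have := euler_integral_ge1_gt0 x1; have := euler_integral_ge1_lty x1.
rewrite euler_integralS//.
case I : (euler_integral x) (euler_integral_ge0 x) => [r| |]//=.
  by rewrite -EFinM !lte_fin ltry pmulr_rgt0// => _ _ ->; rewrite ltry.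
by move=> _; rewrite gt0_muley ?lte_fin.
Qed.

Lemma GammaE (R : realType) (x : R) : 0 < x -> (Gamma x)%:E = euler_integral x.
Proof.
move=> /euler_integral_fin_gt0/andP[p0 poo].
by rewrite /Gamma /Rintegral fineK// fin_numElt poo (lt_trans _ p0)// ltNyr.
Qed.

Lemma Gamma_gt0 (R : realType) (x : R) : 0 < x -> 0 < Gamma x.
Proof.
by move=> x0; rewrite -lte_fin GammaE//; have /andP[] := euler_integral_fin_gt0 x0.
Qed.

Lemma GammaS (R : realType) (x : R) : 0 < x -> Gamma (x + 1) = x * Gamma x.
Proof.
move=> x0; apply: EFin_inj; rewrite EFinM !GammaE ?addr_gt0//.
exact: euler_integralS.
Qed.

Lemma c1 (R : realType) (xi : R) : -1 < xi -> c 1 xi = 1.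
Proof.
move=> xi1; have g : 0 < Gamma (xi + 1) by rewrite Gamma_gt0//; lra.
have G1 : Gamma 1 = 1 :> R by apply: EFin_inj; rewrite GammaE// euler_integral1.
by rewrite /c G1 mul1r addrC divff// gt_eqF.
Qed.

Lemma c_gt0 (R : realType) (n : nat) (xi : R) :
  (1 <= n)%N -> -1 < xi -> 0 < c n xi.
Proof.
move=> n1 xi1; have n1' : (1 : R) <= n%:R by rewrite ler1n.
by rewrite divr_gt0 ?mulr_gt0 ?Gamma_gt0//; lra.
Qed.

Lemma cS (R : realType) (n : nat) (xi : R) : (1 <= n)%N -> -1 < xi ->
  c n.+1 xi = (n%:R + xi) / n%:R * c n xi.
Proof.
move=> n1 xi1; have n1' : (1 : R) <= n%:R by rewrite ler1n.
have g1 : 0 < Gamma (xi + 1) by rewrite Gamma_gt0//; lra.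
have g2 : 0 < Gamma n%:R :> R by rewrite Gamma_gt0//; lra.
rewrite /c -[n.+1]addn1 natrD addrAC.
rewrite (@GammaS _ (n%:R + xi)) 1?(@GammaS _ n%:R); [|lra..].
by field; apply/and3P; split; rewrite gt_eqF//; lra.
Qed.

(** * The line of descent of a step *)

(** The line of descent of [n] reaches [1] with heads all the way.  The range
condition on [b n.+1 t] holds only almost surely in the model; it makes [alive t n]
depend on the times in [2, n] alone, for every outcome [t]. *)
Inductive alive (T : Type) (alpha : nat -> T -> bool) (b : nat -> T -> nat)
    (t : T) : nat -> Prop :=
| alive_first : alive alpha b t 1
| alive_copy n : alpha n.+1 t -> (1 <= b n.+1 t <= n)%N ->
    alive alpha b t (b n.+1 t) -> alive alpha b t n.+1.

Lemma aliveSP (T : Type) (alpha : nat -> T -> bool) (b : nat -> T -> nat)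
    (t : T) (n : nat) : (1 <= n)%N ->
  alive alpha b t n.+1 <->
  [/\ alpha n.+1 t, (1 <= b n.+1 t <= n)%N & alive alpha b t (b n.+1 t)].
Proof.
move=> n1; split=> [A|[]]; last exact: alive_copy.
by inversion A; subst.
Qed.

(** The coins at the times in [J] show heads and the memories there are as prescribed
by [v].  It is against these events that independence is tested: descent by one
generation turns such an event into another one, with one more time in [J]. *)
Definition links (T : Type) (alpha : nat -> T -> bool) (b : nat -> T -> nat)
    (J : {fset nat}) (v : nat -> nat) : set T :=
  [set t | forall j, j \in J -> alpha j t /\ b j t = v j].

(** Coins and memories are independent as whole families, in terms of the generated
sigma-algebras; this puts finite cylinders into these sigma-algebras. *)
Lemma sigma_family_bigcap (d : measure_display) (T : measurableType d)
    (R : realType) (P : probability T R) (d' : measure_display)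
    (T' : measurableType d') (X : nat -> {RV P >-> T'}) (D : set nat)
    (J : {fset nat}) (A : nat -> set T') :
  [set` J] `<=` D -> (forall i, measurable (A i)) ->
  sigma_family D X (\bigcap_(i in [set` J]) (X i @^-1` A i)).
Proof.
move=> JD mA; rewrite /sigma_family.
set G := \bigcup_(i in D) _.
have := @bigcap_measurableType _ (g_sigma_algebraType G)
  (fun i => X i @^-1` A i) [set` J].
apply => i iJ; apply: sub_sigma_algebra.
by exists i; [exact: JD|exists (A i) => //; rewrite setTI].
Qed.

Section elephant.
Context (d : measure_display) (T : measurableType d) (R : realType).
Context (P : probability T R) (p beta : R).
Context (alpha : nat -> {RV P >-> bool}) (b : nat -> {RV P >-> nat}).
Context (X : nat -> {RV P >-> R}).
Hypothesis p01 : 0 < p < 1.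
Hypothesis walkX : laziest_elephant p beta alpha b X.

Let L := links alpha b.
Let E n : set T := [set t | alive alpha b t n].

Lemma prob_coin n : (2 <= n)%N -> P (alpha n @^-1` [set true]) = p%:E.
Proof.
case: n => [//|n] n2.
have /(congr1 (fun m => m [set true])) := coin_law walkX (n2 : 1 <= n)%N.
rewrite /distribution/= /pushforward => ->.
have p01' : 0 <= p <= 1 by case/andP: p01 => ? ?; rewrite !ltW.
rewrite bernoulli_probE//= !diracE (@mem_set _ [set true] true)// memNset//.
by rewrite mule1 mule0 adde0.
Qed.

Lemma linksE J v : L J v =
  \bigcap_(j in [set` J]) (alpha j @^-1` [set true]) `&`
  \bigcap_(j in [set` J]) (b j @^-1` [set v j]).
Proof.
apply/seteqP; split => [t Lt|t [At Bt] j jJ]; last first.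
  by split; [exact: At|exact: Bt].
by split=> j /Lt[].
Qed.

Lemma measurable_links J v : measurable (L J v).
Proof.
by rewrite linksE; apply: measurableI; apply: bigcap_measurableType => j _;
  exact: measurable_funPTI.
Qed.

Lemma prob_links J v : (forall j, j \in J -> (2 <= j)%N) ->
  P (L J v) = (\prod_(j <- J) (p%:E * P (b j @^-1` [set v j])))%E.
Proof.
move=> J2; rewrite linksE.
have JD : [set` J] `<=` [set n | (2 <= n)%N] by move=> j; exact: J2.
rewrite (coin_memory_indep walkX); [|exact: sigma_family_bigcap..].
rewrite (coin_indep walkX)// (memory_indep walkX)// big_split/=.
by congr (_ * _)%E; apply: eq_big_seq => j /J2; exact: prob_coin.
Qed.

Lemma alive1 : E 1 = setT.
Proof. by apply/seteqP; split => // t _; exact: alive_first. Qed.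

(** One generation of descent: the events on the right are disjoint, since they
prescribe different memories at time [n.+1]. *)
Lemma aliveS_links n J v : (1 <= n)%N -> (forall j, j \in J -> (n.+1 < j)%N) ->
  E n.+1 `&` L J v = \bigcup_(k in [set` index_iota 1 n.+1])
    (E k `&` L (n.+1 |` J)%fset (fun j => if j == n.+1 then k else v j)).
Proof.
move=> n1 Jn; apply/seteqP; split => t /=.
  move=> [/(aliveSP _ _ _ n1)[an bn Eb] Lt]; exists (b n.+1 t).
    by rewrite /= mem_index_iota ltnS.
  split=> // j; rewrite in_fset1U => /orP[/eqP->|jJ]; first by rewrite eqxx.
  by rewrite gtn_eqF ?Jn//; exact: Lt.
move=> [k /=]; rewrite mem_index_iota ltnS => kn [Ek Lk].
have := Lk n.+1; rewrite fset1U1 eqxx => /(_ isT)[an bn].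
split; first by apply: alive_copy; rewrite ?bn.
move=> j jJ; have := Lk j; rewrite in_fset1U jJ orbT gtn_eqF ?Jn//.
by apply.
Qed.

Lemma links0 v : L fset0 v = setT.
Proof. by apply/seteqP; split => // t _ j. Qed.

Lemma measurable_alive n : measurable (E n).
Proof.
elim/ltn_ind: n => -[_|[_|n IH]].
- by rewrite (_ : E 0 = set0)//; apply/seteqP; split=> // t En; inversion En.
- by rewrite alive1.
- rewrite -[E n.+2]setIT -(links0 (fun=> 0%N)) aliveS_links//.
  apply: fin_bigcup_measurable => // k /=.
  rewrite mem_index_iota => /andP[k1 kn].
  by apply: measurableI; [exact: IH|exact: measurable_links].
Qed.

Let indep_of_later_links k :=
  forall (J : {fset nat}) v, (forall j, j \in J -> (k < j)%N) ->
  P (E k `&` L J v) = (P (E k) * P (L J v))%E.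

(** The inductive step for both [alive_indep] and [prob_aliveS]: the factor in front
of [P (L J v)] does not depend on [J], and [J = fset0] identifies it as
[P (E n.+1)]. *)
Lemma prob_aliveS_links n J v : (1 <= n)%N ->
  (forall k, (1 <= k <= n)%N -> indep_of_later_links k) ->
  (forall j, j \in J -> (n.+1 < j)%N) ->
  P (E n.+1 `&` L J v) =
  ((\sum_(1 <= k < n.+1) (p%:E * P (b n.+1 @^-1` [set k]) * P (E k))) *
   P (L J v))%E.
Proof.
move=> n1 IH Jn; rewrite aliveS_links// measure_fin_bigcup//; last 3 first.
- exact: finite_seq.
- move=> k k' _ _ [t [[_ Lk] [_ Lk']]].
  have [_] := Lk n.+1 (fset1U1 _ _); have [_] := Lk' n.+1 (fset1U1 _ _).
  by rewrite eqxx => -> ->.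
- move=> k /=; rewrite mem_index_iota => /andP[k1 _].
  by apply: measurableI; [exact: measurable_alive|exact: measurable_links].
rewrite -fsbig_seq ?iota_uniq// ge0_sume_distrl; last first.
  by move=> k _; rewrite !mule_ge0// lee_fin; case/andP: p01 => /ltW.
apply: eq_big_seq => k; rewrite mem_index_iota ltnS => kn.
have nJ : n.+1 \notin J by apply/negP => /Jn; rewrite ltnn.
have PL : P (L (n.+1 |` J)%fset (fun j => if j == n.+1 then k else v j)) =
    (p%:E * P (b n.+1 @^-1` [set k]) * P (L J v))%E.
  rewrite !prob_links.
  - rewrite big_fsetU1//= eqxx; congr (_ * _)%E.
    by apply: eq_big_seq => j /Jn jn; rewrite gtn_eqF.
  - by move=> j /Jn/ltnW/(leq_trans _)->.
  - by move=> j; rewrite in_fset1U => /orP[/eqP->|/Jn/ltnW/(leq_trans _)->].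
apply: etrans (IH k kn _ _ _) _.
  move=> j; rewrite in_fset1U; case/andP: kn => _ kn.
  by move=> /orP[/eqP->//|/Jn/ltnW]; apply: leq_trans.
apply: etrans (congr1 (fun z => P (E k) * z)%E PL) _.
by rewrite muleA (muleC (P (E k))).
Qed.

Lemma alive_indep n : (1 <= n)%N -> indep_of_later_links n.
Proof.
elim/ltn_ind: n => -[//|[_ _|n IH _]] J v Jn.
  by rewrite alive1 setTI probability_setT mul1e.
have IH' k : (1 <= k <= n.+1)%N -> indep_of_later_links k.
  by move=> /andP[k1 kn]; apply: IH.
rewrite prob_aliveS_links//; congr (_ * _)%E.
rewrite -[E n.+2]setIT -(links0 (fun=> 0%N)) prob_aliveS_links//.
by rewrite links0 probability_setT mule1.
Qed.

Lemma prob_aliveS n : (1 <= n)%N ->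
  P (E n.+1) = (\sum_(1 <= k < n.+1) (p%:E * P (b n.+1 @^-1` [set k]) * P (E k)))%E.
Proof.
move=> n1; rewrite -[E n.+1]setIT -(links0 (fun=> 0%N)) prob_aliveS_links//.
  by rewrite links0 probability_setT mule1.
by move=> k /andP[k1 _]; exact: alive_indep.
Qed.

(** The recursion and the range of the memories hold almost surely simultaneously for
all times; for a fixed outcome the identity is then a strong induction. *)
Lemma step_indicator_ae :
  {ae P, forall t, forall n, (1 <= n)%N -> X n t = \1_(E n) t}.
Proof.
have H : {ae P, forall t, forall n, (1 <= n)%N ->
    X n.+1 t = (alpha n.+1 t)%:R * X (b n.+1 t) t}.
  apply: ae_foralln => n; case: n => [|n].
    exact: aeW.
  have := next_step walkX (ltn0Sn n).
  by apply: filterS => t + _.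
have B : {ae P, forall t, forall n, (1 <= n)%N -> (1 <= b n.+1 t <= n)%N}.
  apply: ae_foralln => n; case: n => [|n]; first exact: aeW.
  suff : {ae P, forall t, forall k, b n.+2 t = k -> (1 <= k <= n.+1)%N}.
    by apply: filterS => t + _; exact.
  apply: ae_foralln => k.
  have [kn|kn] := boolP (1 <= k <= n.+1)%N; first exact: aeW.
  exists (b n.+2 @^-1` [set k]); split; first exact: measurable_funPTI.
    by have := memory_law walkX k (ltn0Sn n); rewrite (negbTE kn).
  by move=> t /=; apply: contra_notP => bk /bk.
apply: filterS2 H B => t Ht Bt.
elim/ltn_ind => -[//|[_ _|n IH _]].
  by rewrite (first_step walkX) indicE mem_set//; exact: alive_first.
have /andP[b1 bn] := Bt n.+1 (ltn0Sn n).
rewrite Ht// IH ?ltnS// !indicE.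
have EP := aliveSP alpha b t (ltn0Sn n).
have [an|an] := boolP (alpha n.+2 t); last first.
  by rewrite mul0r memNset// => /EP[]; rewrite (negbTE an).
rewrite mul1r; congr (nat_of_bool _)%:R.
apply/idP/idP => /set_mem En; apply/mem_set; last by case/EP: En.
by apply/EP; rewrite an b1 bn.
Qed.

Lemma expectation_walk n : ('E_P[walk X n] = \sum_(1 <= k < n.+1) P (E k))%E.
Proof.
rewrite unlock.
have mX : measurable_fun setT (walk X n).
  by apply: measurable_sum => k.
rewrite (@ae_eq_integral _ _ _ P setT
  (fun t => \sum_(1 <= k < n.+1) (\1_(E k) t)%:E)%E)//.
- rewrite ge0_integral_sum//.
  + apply: eq_bigr => k _; rewrite integral_indic ?setIT//.
    exact: measurable_alive.
  + move=> k; apply/measurable_EFinP; apply: measurable_indic.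
    exact: measurable_alive.
- exact/measurable_EFinP.
- apply: emeasurable_sum => k; apply/measurable_EFinP; apply: measurable_indic.
  exact: measurable_alive.
- apply: filterS step_indicator_ae => t Xt _; rewrite /walk sumEFin; congr EFin.
  by apply: eq_big_seq => k; rewrite mem_index_iota => /andP[k1 _]; exact: Xt.
Qed.

Lemma mean_recursion (a : nat -> R) :
  (forall n, (1 <= n)%N -> P (E n) = (a n)%:E) ->
  a 1%N = 1 /\ forall n, (1 <= n)%N -> a n.+1 = \sum_(1 <= k < n.+1)
    (p * ((beta + 1) / n%:R * (c k beta / c n.+1 beta)) * a k).
Proof.
move=> aE; split; first by apply: EFin_inj; rewrite -aE// alive1 probability_setT.
move=> n n1; apply: EFin_inj; rewrite -aE// prob_aliveS// -sumEFin.
apply: eq_big_seq => k; rewrite mem_index_iota => /andP[k1 kn].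
by rewrite (memory_law walkX)// k1 -ltnS kn aE// -!EFinM.
Qed.

End elephant.

(** * Solving the recursion *)

(** The recursion determines the weighted sums, and
[1 + g / n = (n + g) / n] is the ratio of [c n.+1 g] to [c n g]. *)
Lemma weighted_sum_mean (R : realType) (g beta : R) (a : nat -> R) (n : nat) :
  -1 < g -> -1 < beta -> a 1%N = 1 ->
  (forall m, (1 <= m)%N -> a m.+1 =
    g / m%:R / c m.+1 beta * \sum_(1 <= k < m.+1) c k beta * a k) ->
  (1 <= n)%N -> \sum_(1 <= k < n.+1) c k beta * a k = c n g.
Proof.
move=> g1 beta1 a1 aS; case: n => // n _; elim: n => [|n IH].
  by rewrite big_nat1 a1 mulr1 !c1.
rewrite big_nat_recr//= aS// IH (@cS _ n.+1 g)//.
have cb : c n.+2 beta != 0 by rewrite gt_eqF// c_gt0.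
have n0 : n.+1%:R != 0 :> R by rewrite pnatr_eq0.
move: cb n0; move: (c n.+2 beta) (c n.+1 g) n.+1%:R => x y z x0 z0.
by field; rewrite x0 z0.
Qed.

(** Telescoping: [c m g / c m beta] has increments [(g - beta) / (m + beta) *
(c m g / c m beta)], and [a m.+1] is the same expression with [g] in place of
[g - beta].  At [g = beta] the ratio is constantly [1]. *)
Lemma sum_mean (R : realType) (g beta : R) (a : nat -> R) (n : nat) :
  -1 < g -> -1 < beta -> a 1%N = 1 ->
  (forall m, (1 <= m)%N -> a m.+1 =
    g / m%:R / c m.+1 beta * \sum_(1 <= k < m.+1) c k beta * a k) ->
  (1 <= n)%N ->
  \sum_(1 <= k < n.+1) a k =
    if g != beta
    then g / (g - beta) * (c n g / c n beta) + beta / (beta - g)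
    else 1 + \sum_(1 <= k < n) beta / (k%:R + beta).
Proof.
move=> g1 beta1 a1 aS.
have mean_step m : (0 < m)%N -> a m.+1 = g / (m%:R + beta) * (c m g / c m beta).
  move=> m0; rewrite aS// (weighted_sum_mean g1 beta1 a1 aS)// (@cS _ m beta)//.
  have cb : c m beta != 0 by rewrite gt_eqF// c_gt0.
  have m1 : (1 : R) <= m%:R by rewrite ler1n.
  have m0' : m%:R != 0 :> R by rewrite pnatr_eq0 -lt0n.
  have mb : m%:R + beta != 0 :> R by rewrite gt_eqF//; lra.
  move: cb m0' mb; move: (c m beta) (c m g) => x y x0 z0 z1.
  by field; rewrite x0 z0 z1.
case: n => // n _; have [gE|gN] := eqVneq g beta => /=; elim: n => [|n IH].
- by rewrite big_nat1 big_geq// a1 addr0.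
- rewrite big_nat_recr//= IH [in RHS]big_nat_recr//= addrA; congr (_ + _).
  by rewrite mean_step// gE divff ?mulr1// gt_eqF// c_gt0.
- rewrite big_nat1 a1 !c1// divr1 mulr1.
  have gN1 : g - beta != 0 by rewrite subr_eq0.
  have gN2 : beta - g != 0 by rewrite subr_eq0 eq_sym.
  by field; rewrite gN1 gN2.
- rewrite big_nat_recr//= IH mean_step// (@cS _ n.+1 beta)// (@cS _ n.+1 g)//.
  have gN1 : g - beta != 0 by rewrite subr_eq0.
  have gN2 : beta - g != 0 by rewrite subr_eq0 eq_sym.
  have cb : c n.+1 beta != 0 by rewrite gt_eqF// c_gt0.
  have m1 : (1 : R) <= n.+1%:R by rewrite ler1n.
  have m0 : n.+1%:R != 0 :> R by rewrite pnatr_eq0.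
  have mb : n.+1%:R + beta != 0 :> R by rewrite gt_eqF//; lra.
  move: cb m0 mb; move: (c n.+1 beta) (c n.+1 g) n.+1%:R {m1} => x y z x0 z0 z1.
  by field; rewrite x0 z0 z1 gN1 gN2.
Qed.

Theorem theorem2p1 (d : measure_display) (T : measurableType d) (R : realType)
    (P : probability T R) (p beta : R)
    (alpha : nat -> {RV P >-> bool}) (b : nat -> {RV P >-> nat})
    (X : nat -> {RV P >-> R}) (n : nat) :
  0 < p < 1 -> -1 < beta ->
  laziest_elephant p beta alpha b X ->
  (1 <= n)%N ->
  ('E_P[walk X n] =
    (if beta != p / (1 - p)
     then p * (beta + 1) / (p * (beta + 1) - beta)
            * (c n (p * (beta + 1)) / c n beta)
          + beta / (beta - p * (beta + 1))
     else \sum_(0 <= k < n) beta / (k%:R + beta))%:E)%E.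
Proof.
move=> p01 beta1 walkX n1; rewrite (expectation_walk walkX).
pose a k := fine (P [set t | alive alpha b t k]).
have aE k : (1 <= k)%N -> P [set t | alive alpha b t k] = (a k)%:E.
  move=> k1; rewrite fineK// fin_num_measure//.
  exact: measurable_alive.
have [a1 aS] := mean_recursion p01 walkX aE.
have -> : (\sum_(1 <= k < n.+1) P [set t | alive alpha b t k] =
    (\sum_(1 <= k < n.+1) a k)%:E)%E.
  rewrite -sumEFin; apply: eq_big_seq => k.
  by rewrite mem_index_iota => /andP[k1 _]; exact: aE.
have g0 : 0 < p * (beta + 1) by case/andP: p01 => p0 _; rewrite mulr_gt0//; lra.
rewrite (@sum_mean _ (p * (beta + 1)) beta)//; [|lra|]; last first.
  move=> m m1; rewrite aS// mulr_sumr; apply: eq_bigr => k _.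
  by move: (c k beta) (c m.+1 beta) => x y; ring.
have gb : (beta == p / (1 - p)) = (p * (beta + 1) == beta).
  have q0 : 1 - p != 0 by rewrite gt_eqF//; lra.
  by rewrite -(inj_eq (mulIf q0)) divfK//; apply/eqP/eqP => ?; lra.
rewrite gb; case: (p * _ =P beta) => // gE /=.
(* the term of index [0] on the right is [beta / beta]; here [beta = g > 0] *)
by rewrite [in RHS](big_ltn n1) add0r divff// -gE gt_eqF.
Qed.
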